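(* Let $q=2$. Then: (a) there are no irreducible $\mathbb{P}^1\times\mathbb{P}^1$-filling curves over $\mathbb{F}_2$ of bi-degree $(3,3)$; (b) there are nonsingular irreducible $\mathbb{P}^1\times\mathbb{P}^1$-filling curves over $\mathbb{F}_2$ of bi-degree $(4,3)$, and of bi-degree $(3,4)$.
   Context: $\mathbb{F}_2$ is the field with $2$ elements. A curve on $\mathbb{P}^1\times\mathbb{P}^1$ over $\mathbb{F}_2$ of bi-degree $(a,b)$ is the zero locus $C$ of a nonzero polynomial $F(X_0,X_1;Y_0,Y_1)\in\mathbb{F}_2[X_0,X_1,Y_0,Y_1]$ that is homogeneous of degree $a$ in $X_0,X_1$ (coordinates of the first factor) and homogeneous of degree $b$ in $Y_0,Y_1$ (coordinates of the second factor). The curve is irreducible if $F$ is irreducible. It is nonsingular if, over an algebraic closure of $\mathbb{F}_2$, the corresponding scheme $F=0$ has no singular point; this is guaranteed if $F$ and its four partial derivatives with respect to $X_0,X_1,Y_0,Y_1$ have no common zero on $\mathbb{P}^1\times\mathbb{P}^1$ over the algebraic closure. $C$ is called a $\mathbb{P}^1\times\mathbb{P}^1$-filling curve over $\mathbb{F}_2$ if its set of $\mathbb{F}_2$-points satisfies $C(\mathbb{F}_2)=\mathbb{P}^1(\mathbb{F}_2)\times\mathbb{P}^1(\mathbb{F}_2)$. *)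

(* Defs.v *)
From HB Require Import structures.
From mathcomp Require Import all_boot all_order all_algebra all_field.
From mathcomp Require Import mpoly.

Set Implicit Arguments.
Unset Strict Implicit.
Unset Printing Implicit Defensive.

Import GRing.Theory.
Local Open Scope ring_scope.

(* The variables X_0, X_1, Y_0, Y_1 are 'X_i for i = 0, 1, 2, 3 in 'I_(2 + 2):
   X_i is indexed by lshift 2 i and Y_j by rshift 2 j. *)
Definition coordX (i : 'I_2) : 'I_(2 + 2) := lshift 2 i.
Definition coordY (j : 'I_2) : 'I_(2 + 2) := rshift 2 j.

Definition bihomogeneous (R : nzRingType) (a b : nat)
    (F : {mpoly R[2 + 2]}) : bool :=
  all (fun m : 'X_{1..(2 + 2)} =>
         (\sum_(i < 2) m (coordX i) == a)%N && (\sum_(j < 2) m (coordY j) == b)%N)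
      (msupp F).

(* Curves of bi-degree (a, b) on P^1 x P^1 are represented by their
   equations. *)
Definition curve_equation (R : nzRingType) (a b : nat)
    (F : {mpoly R[2 + 2]}) : Prop :=
  F != 0 /\ bihomogeneous a b F.

Definition irreducible_mpoly (k : fieldType) (n : nat)
    (F : {mpoly k[n]}) : Prop :=
  [/\ F != 0, F \isn't a GRing.unit &
      forall G H : {mpoly k[n]},
        F = G * H -> G \is a GRing.unit \/ H \is a GRing.unit].

(* Points of P^1 and P^1 x P^1 are given by homogeneous coordinates; the set
   of all nonzero coordinate vectors stands for P^1(k), and the vanishing of a
   bihomogeneous form does not depend on the chosen representatives. *)
Definition P1_coords (k : finFieldType) : {set 'rV[k]_2} :=
  [set x | x != 0].

Definition eval_at (R : comNzRingType) (F : {mpoly R[2 + 2]})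
    (x y : 'rV[R]_2) : R :=
  F.@[fun i : 'I_(2 + 2) => row_mx x y 0 i].

Definition curve_points (k : finFieldType) (F : {mpoly k[2 + 2]}) :
    {set 'rV[k]_2 * 'rV[k]_2} :=
  [set p in setX (P1_coords k) (P1_coords k) | eval_at F p.1 p.2 == 0].

Definition filling (k : finFieldType) (F : {mpoly k[2 + 2]}) : Prop :=
  curve_points F = setX (P1_coords k) (P1_coords k).

(* The equation of the curve on the affine chart X_i <> 0, Y_j <> 0, in the
   affine coordinates 'X_0 = X_i' / X_i and 'X_1 = Y_j' / Y_j, where i' and j'
   are the indices other than i and j. *)
Definition dehomogenize (R : comNzRingType) (i j : 'I_2)
    (F : {mpoly R[2 + 2]}) : {mpoly R[2]} :=
  F \mPo [tuple match split s with
                | inl i1 => if i1 == i then 1 else 'X_ord0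
                | inr j1 => if j1 == j then 1 else 'X_ord_max
                end | s < 2 + 2].

Definition affine_singular_point (K : fieldType) (f : {mpoly K[2]})
    (z : 'I_2 -> K) : Prop :=
  f.@[z] = 0 /\ forall s : 'I_2, (f^`M(s)).@[z] = 0.

Definition nonsingular_over (K : fieldType) (F : {mpoly K[2 + 2]}) : Prop :=
  forall (i j : 'I_2) (z : 'I_2 -> K),
    ~ affine_singular_point (dehomogenize i j F) z.

(* An algebraic closure of k: algebraically closed and algebraic over k. It
   exists for countable k by countable_algebraic_closure, and is unique up to
   isomorphism over k, so that quantifying over all of them is harmless. *)
Definition nonsingular (k : fieldType) (F : {mpoly k[2 + 2]}) : Prop :=
  forall (K : closedFieldType) (iota : {rmorphism k -> K}),
    integralRange iota -> nonsingular_over (map_mpoly iota F).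

(* Main.v *)
Require Import Defs.
From HB Require Import structures.
From mathcomp Require Import all_boot all_order all_algebra all_field.
From mathcomp Require Import mpoly ring.
Local Open Scope ring_scope.

(** Write A(u,v) = uv(u + v), the product of the linear forms of the three
    points of P^1(F_2).

    (a) A form of bi-degree (3,3) that vanishes at the nine points of
    P^1(F_2) x P^1(F_2) is A(X) g(Y) + A(Y) f(X) with f and g binary cubics
    ([filling_bicubic]).  If f has a zero in P^1(F_2), then f and A(X) share the
    linear form of that zero, which therefore divides the whole form; likewise
    for g.  Otherwise f and g lie in the pair consisting of
    phi(u,v) = u^3 + u^2 v + v^3 and phi(v,u).  Since A is symmetric, swapping
    X_0, X_1 and Y_0, Y_1 as needed turns the form into
    A(X) phi(Y) + A(Y) phi(X), which vanishes on the diagonal, hence is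
    divisible by X_0 Y_1 + X_1 Y_0: the curve contains the graph of an
    automorphism of P^1 ([bicubic_factors]).

    (b) The curve
      A(X) (X_1 Y_0^3 + X_0 Y_1^3) + (X_0^2 + X_0 X_1 + X_1^2)^2 A(Y) = 0
    of bi-degree (4,3) is filling because A vanishes on P^1(F_2).
    Irreducibility is read off at X = (w,1), where w in F_4 is a root of
    t^2 + t + 1: there the form becomes Y_0^3 + w Y_1^3, which has no linear
    factor over F_4 because the only cubes in F_4 are 0 and 1.  So one of two
    factors has degree 0 in Y_0; it divides the coefficient A(X) X_1 of Y_0^3,
    hence is up to a constant a product of forms X_0, X_1, X_0 + X_1, none of
    which divides the equation ([fill_form_irreducible]).  Smoothness is a hand
    elimination on the charts ([smooth_chart_same], [smooth_chart_mixed]): the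
    swap of X_0 with X_1 and Y_0 with Y_1 preserves the equation, so two of the
    four charts suffice.  Exchanging the roles of X and Y gives bi-degree
    (3,4). *)

Set Implicit Arguments.
Unset Strict Implicit.
Unset Printing Implicit Defensive.

Import GRing.Theory.

(** * Characteristic two *)

Lemma rmorph_two_eq0 (R S : nzRingType) (e : {rmorphism R -> S}) :
  2%:R = 0 :> R -> 2%:R = 0 :> S.
Proof. by move=> two0; rewrite -(rmorph_nat e) two0 rmorph0. Qed.

Lemma two_eq0_F2 : 2%:R = 0 :> 'F_2.
Proof. exact: val_inj. Qed.

Lemma addrr_two_eq0 (R : nzRingType) (x : R) : 2%:R = 0 :> R -> x + x = 0.
Proof. by move=> two0; rewrite -mulr2n -mulr_natl two0 mul0r. Qed.

Lemma oppr_two_eq0 (R : nzRingType) (x : R) : 2%:R = 0 :> R -> - x = x.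
Proof. by move=> two0; apply/eqP; rewrite eq_sym -addr_eq0 addrr_two_eq0. Qed.

Lemma F2P (a : 'F_2) : a = 0 \/ a = 1.
Proof. by case: a => [[|[|m]] ltm] //; [left | right]; apply: val_inj. Qed.

(** * The cubic of the rational points *)

Definition rat_cubic (R : comNzRingType) (u v : R) : R := u * v * (u + v).

Lemma rmorph_rat_cubic (R S : comNzRingType) (f : {rmorphism R -> S}) u v :
  f (rat_cubic u v) = rat_cubic (f u) (f v).
Proof. by rewrite /rat_cubic !(rmorphM, rmorphD). Qed.

Lemma rat_cubicC (R : comNzRingType) (u v : R) : rat_cubic u v = rat_cubic v u.
Proof. by rewrite /rat_cubic; ring. Qed.

Lemma rat_cubic_F2 (u v : 'F_2) : rat_cubic u v = 0.
Proof.
by rewrite /rat_cubic; case: (F2P u) (F2P v) => -> [] ->; apply: val_inj.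
Qed.

(** * Bihomogeneous forms *)

Lemma ord2P (i : 'I_2) : i = ord0 \/ i = ord_max.
Proof. by case: i => [[|[|i]] lti] //; [left | right]; apply/val_inj. Qed.

Lemma coordP (i : 'I_(2 + 2)) :
  [\/ i = coordX ord0, i = coordX ord_max, i = coordY ord0 | i = coordY ord_max].
Proof.
rewrite -[i]splitK; case: (split i) => l; case: (ord2P l) => -> /=.
- exact: Or41.
- exact: Or42.
- exact: Or43.
- exact: Or44.
Qed.

Lemma sum_ord2 (f : 'I_2 -> nat) : (\sum_(i < 2) f i = f ord0 + f ord_max)%N.
Proof.
rewrite big_ord_recr big_ord1; congr (f _ + _)%N; exact/val_inj.
Qed.

Section Bihomogeneous.
Variable R : comNzRingType.
Implicit Types F G : {mpoly R[2 + 2]}.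

Lemma bihomogeneousD a b F G :
  bihomogeneous a b F -> bihomogeneous a b G -> bihomogeneous a b (F + G).
Proof.
move=> /allP hF /allP hG; apply/allP => m /msuppD_le.
by rewrite mem_cat => /orP[/hF|/hG].
Qed.

Lemma bihomogeneousM a b a' b' F G : bihomogeneous a b F ->
  bihomogeneous a' b' G -> bihomogeneous (a + a') (b + b') (F * G).
Proof.
move=> /allP hF /allP hG; apply/allP => m /msuppM_le /allpairsP[[m1 m2] /=].
move=> [/hF/andP[/eqP ea /eqP eb] /hG/andP[/eqP ea' /eqP eb'] ->].
apply/andP; rewrite -ea -eb -ea' -eb' -!big_split /=.
by split; apply/eqP/eq_bigr => i _; rewrite mnmDE.
Qed.

Lemma bihomogeneous_coordX i : bihomogeneous 1 0 ('X_(coordX i) : {mpoly R[2 + 2]}).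
Proof.
rewrite /bihomogeneous msuppX /= andbT !big_ord_recl !big_ord0 !mnm1E.
by case: (ord2P i) => ->.
Qed.

Lemma bihomogeneous_coordY i : bihomogeneous 0 1 ('X_(coordY i) : {mpoly R[2 + 2]}).
Proof.
rewrite /bihomogeneous msuppX /= andbT !big_ord_recl !big_ord0 !mnm1E.
by case: (ord2P i) => ->.
Qed.

Lemma bihomogeneousX a b F r :
  bihomogeneous a b F -> bihomogeneous (a * r.+1) (b * r.+1) (F ^+ r.+1).
Proof.
move=> hF; elim: r => [|r IH]; first by rewrite !muln1 expr1.
by rewrite exprS !(mulnS _ r.+1); apply: bihomogeneousM.
Qed.

Lemma bihomogeneous_rat_cubic a b (u v : {mpoly R[2 + 2]}) :
  bihomogeneous a b u -> bihomogeneous a b v ->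
  bihomogeneous (a * 3) (b * 3) (rat_cubic u v).
Proof.
move=> hu hv; rewrite !mulnSr !muln0 !add0n.
by apply: bihomogeneousM; [apply: bihomogeneousM | apply: bihomogeneousD].
Qed.

End Bihomogeneous.

Definition bimonomial (a b i j : nat) : 'X_{1..(2 + 2)} :=
  (U_(coordX ord0) *+ i + U_(coordX ord_max) *+ (a - i)
   + (U_(coordY ord0) *+ j + U_(coordY ord_max) *+ (b - j)))%MM.

Lemma bimonomialE a b i j :
  (bimonomial a b i j (coordX ord0) = i) * (bimonomial a b i j (coordX ord_max) = a - i)%N
  * (bimonomial a b i j (coordY ord0) = j) * (bimonomial a b i j (coordY ord_max) = b - j)%N.
Proof.
rewrite /bimonomial !mnmDE !mulmnE !mnm1E /=.
by rewrite !(muln0, mul0n, mul1n, muln1, addn0, add0n).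
Qed.

Lemma bihomogeneous_expand (R : comNzRingType) a b (F : {mpoly R[2 + 2]}) :
  bihomogeneous a b F ->
  F = \sum_(p : 'I_a.+1 * 'I_b.+1) F@_(bimonomial a b p.1 p.2) *: 'X_[bimonomial a b p.1 p.2].
Proof.
move=> /allP hF; apply/mpolyP => m; rewrite raddf_sum /=.
under eq_bigr do rewrite mcoeffZ mcoeffX.
have [/hF/andP[/eqP da /eqP db]|mF] := boolP (m \in msupp F); last first.
  rewrite (memN_msupp_eq0 mF) big1 // => p _.
  by case: eqP => [->|_]; rewrite ?mulr0 // memN_msupp_eq0 ?mul0r.
move: da db; rewrite !sum_ord2 => da db.
have ltx : (m (coordX ord0) < a.+1)%N by rewrite ltnS -da leq_addr.
have lty : (m (coordY ord0) < b.+1)%N by rewrite ltnS -db leq_addr.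
(* A monomial of the support is determined by its exponents in X_0 and Y_0. *)
have em : bimonomial a b (Ordinal ltx) (Ordinal lty) = m.
  by apply/mnmP => i; case: (coordP i) => ->; rewrite bimonomialE //= -?da -?db addKn.
rewrite (bigD1 (Ordinal ltx, Ordinal lty)) //= em eqxx mulr1 big1 ?addr0 //.
case=> i j /= ne; case: eqP => [e|_]; last by rewrite mulr0.
by case/eqP: ne; congr (_, _); apply: val_inj; rewrite /= -e bimonomialE.
Qed.

(** * Bicubics through all rational points *)

Definition form3 (R : comNzRingType) (c : nat -> R) (u v : R) : R :=
  c 0%N * v ^+ 3 + c 1%N * u * v ^+ 2 + c 2%N * u ^+ 2 * v + c 3%N * u ^+ 3.

Lemma rmorph_form3_form3 (R S : comNzRingType) (f : {rmorphism R -> S})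
    (c : nat -> nat -> R) x0 x1 y0 y1 :
  f (form3 (fun i => form3 (c i) y0 y1) x0 x1) =
  form3 (fun i => form3 (fun j => f (c i j)) (f y0) (f y1)) (f x0) (f x1).
Proof. by rewrite /form3 !(rmorphD, rmorphM, rmorphXn). Qed.

Lemma eq_form3_form3 (R : comNzRingType) (c c' : nat -> nat -> R) x0 x1 y0 y1 :
  c =2 c' -> form3 (fun i => form3 (c i) y0 y1) x0 x1
           = form3 (fun i => form3 (c' i) y0 y1) x0 x1.
Proof. by move=> e; rewrite /form3 !e. Qed.

Lemma form3E (R : comNzRingType) (c : nat -> R) u v :
  form3 c u v = \sum_(i < 4) c i * (u ^+ i * v ^+ (3 - i)).
Proof.
rewrite !big_ord_recl big_ord0 /= /bump /= !add1n /form3.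
rewrite -[(3 - 0)%N]/3%N -[(3 - 1)%N]/2%N -[(3 - 2)%N]/1%N -[(3 - 3)%N]/0%N.
by rewrite !expr0 !expr1 !mul1r !mulr1 addr0 !addrA !mulrA.
Qed.

(** Nesting the cubics lets vanishing conditions be exploited in x first and
    then in y. *)
Lemma form3_form3E (R : comNzRingType) (c : nat -> nat -> R) x0 x1 y0 y1 :
  form3 (fun i => form3 (c i) y0 y1) x0 x1 = \sum_(p : 'I_4 * 'I_4)
    c p.1 p.2 * (x0 ^+ p.1 * x1 ^+ (3 - p.1) * (y0 ^+ p.2 * y1 ^+ (3 - p.2))).
Proof.
rewrite form3E -(pair_bigA _ (fun i j : 'I_4 => c i j
  * (x0 ^+ i * x1 ^+ (3 - i) * (y0 ^+ j * y1 ^+ (3 - j))))) /=.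
apply: eq_bigr => i _; rewrite form3E big_distrl; apply: eq_bigr => j _ /=.
by rewrite -mulrA; congr (_ * _); apply: mulrC.
Qed.

Lemma bicubic_expand (R : comNzRingType) (F : {mpoly R[2 + 2]}) :
  bihomogeneous 3 3 F ->
  F = form3 (fun i => form3 (fun j => (F@_(bimonomial 3 3 i j))%:MP)
                        'X_(coordY ord0) 'X_(coordY ord_max))
        'X_(coordX ord0) 'X_(coordX ord_max).
Proof.
move/bihomogeneous_expand => {1}->; rewrite form3_form3E.
by apply: eq_bigr => p _; rewrite -mul_mpolyC !mpolyXD !mpolyXn.
Qed.

(** Vanishing at (0,1), (1,0) and (1,1) gives the three relations: these cubics
    are the multiples of [rat_cubic]. *)
Lemma form3_F2_vanish (c : nat -> 'F_2) :
  (forall u v, (u != 0) || (v != 0) -> form3 c u v = 0) ->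
  [/\ c 0%N = 0, c 3%N = 0 & c 2%N = c 1%N].
Proof.
move=> h; have c0 : c 0%N = 0.
  by rewrite -(h 0 1 isT) /form3 !(expr0n, expr1n) /= !(mulr0, mul0r, mulr1, addr0).
have c3 : c 3%N = 0.
  by rewrite -(h 1 0 isT) /form3 !(expr0n, expr1n) /= !(mulr0, mul0r, mulr1, add0r).
split=> //; have := h 1 1 isT.
rewrite /form3 c0 c3 !expr1n !(mulr1, mul0r, add0r, addr0) => /eqP.
rewrite addr_eq0 => /eqP e; rewrite e.
by rewrite oppr_two_eq0 ?two_eq0_F2.
Qed.

Lemma filling_eval (F : {mpoly 'F_2[2 + 2]}) (a b c d : 'F_2) : filling F ->
  (a != 0) || (b != 0) -> (c != 0) || (d != 0) ->
  exists v : 'I_(2 + 2) -> 'F_2, [/\ F.@[v] = 0,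
    v (coordX ord0) = a, v (coordX ord_max) = b, v (coordY ord0) = c & v (coordY ord_max) = d].
Proof.
move=> fF ab cd.
pose vec (s t : 'F_2) : 'rV['F_2]_2 := \row_k (if k == ord0 then s else t).
have vec_nz s t : (s != 0) || (t != 0) -> vec s t != 0.
  apply: contraTneq => /matrixP e; have := e ord0 ord0; have := e ord0 ord_max.
  by rewrite !mxE /= => -> ->.
exists (fun i => row_mx (vec a b) (vec c d) 0 i).
have /setP/(_ (vec a b, vec c d)) := fF; rewrite !inE /= !vec_nz //= => /eqP.
by rewrite !(row_mxEl, row_mxEr) !mxE /=.
Qed.

Lemma form3B (R : comNzRingType) (c c' : nat -> R) u v :
  form3 (fun j => c j - c' j) u v = form3 c u v - form3 c' u v.
Proof. by rewrite /form3; ring. Qed.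

(** In matrix terms: rows 0 and 3 of the coefficients are multiples of the row
    of [rat_cubic], and so is the difference of rows 2 and 1; so subtracting
    A(x) times row 1 leaves a multiple of A(y).  The morphism [e] lets
    the relations be checked in the coefficient ring and used among
    polynomials. *)
Lemma form3_rat_cubic (R S : comNzRingType) (e : {rmorphism R -> S})
    (c : nat -> nat -> R) (x0 x1 y0 y1 : S) :
  [/\ c 0%N 0%N = 0, c 0%N 3%N = 0 & c 0%N 2%N = c 0%N 1%N] ->
  [/\ c 3%N 0%N = 0, c 3%N 3%N = 0 & c 3%N 2%N = c 3%N 1%N] ->
  [/\ c 2%N 0%N - c 1%N 0%N = 0, c 2%N 3%N - c 1%N 3%N = 0
     & c 2%N 2%N - c 1%N 2%N = c 2%N 1%N - c 1%N 1%N] ->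
  form3 (fun i => form3 (fun j => e (c i j)) y0 y1) x0 x1 =
    rat_cubic x0 x1 * form3 (fun j => e (c 1%N j)) y0 y1
    + rat_cubic y0 y1 * form3
        (fun i => e (nth 0 [:: c 0%N 1%N; 0; c 2%N 1%N - c 1%N 1%N; c 3%N 1%N] i)) x0 x1.
Proof.
move=> [c00 c03 c02] [c30 c33 c32] [/subr0_eq c20 /subr0_eq c23 c22].
have {}c22 : c 2%N 2%N = c 1%N 2%N + (c 2%N 1%N - c 1%N 1%N).
  by rewrite -c22 addrC subrK.
rewrite /form3 /= c00 c03 c02 c30 c33 c32 c20 c23 c22 !rmorph0 rmorphD rmorphB.
by rewrite /rat_cubic; ring.
Qed.

Lemma mpolyC_F2 n (a : 'F_2) : a%:MP_[n] = 0 \/ a%:MP_[n] = 1.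
Proof. by case: (F2P a) => ->; [left; apply: mpolyC0 | right; apply: mpolyC1]. Qed.

Lemma filling_bicubic (F : {mpoly 'F_2[2 + 2]}) :
  bihomogeneous 3 3 F -> filling F ->
  exists g f : nat -> {mpoly 'F_2[2 + 2]},
  [/\ forall i, g i = 0 \/ g i = 1, forall i, f i = 0 \/ f i = 1 &
    F = rat_cubic 'X_(coordX ord0) 'X_(coordX ord_max)
          * form3 g 'X_(coordY ord0) 'X_(coordY ord_max)
        + rat_cubic 'X_(coordY ord0) 'X_(coordY ord_max)
          * form3 f 'X_(coordX ord0) 'X_(coordX ord_max)].
Proof.
move=> hF fF.
(* First fix y: the form is a cubic in x that vanishes at the three rational
   points, which relates its coefficients c i j as cubics in y; these relations
   hold at the three points y, so the same lemma applies again. *)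
pose c i j := F@_(bimonomial 3 3 i j).
have vanish s t : (s != 0) || (t != 0) -> forall a b, (a != 0) || (b != 0) ->
    form3 (fun i => form3 (c i) s t) a b = 0.
  move=> st a b ab; have [v [<- <- <- <- <-]] := filling_eval fF ab st.
  rewrite {1}(bicubic_expand hF) (rmorph_form3_form3 (meval v)) /= !mevalXU.
  by apply: eq_form3_form3 => i j; rewrite mevalC.
have col s t (st : (s != 0) || (t != 0)) := form3_F2_vanish (vanish s t st).
have row0 : [/\ c 0%N 0%N = 0, c 0%N 3%N = 0 & c 0%N 2%N = c 0%N 1%N].
  by apply: form3_F2_vanish => s t /col[].
have row3 : [/\ c 3%N 0%N = 0, c 3%N 3%N = 0 & c 3%N 2%N = c 3%N 1%N].
  by apply: form3_F2_vanish => s t /col[].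
have row21 : [/\ c 2%N 0%N - c 1%N 0%N = 0, c 2%N 3%N - c 1%N 3%N = 0
    & c 2%N 2%N - c 1%N 2%N = c 2%N 1%N - c 1%N 1%N].
  apply: (form3_F2_vanish (c := fun j => c 2%N j - c 1%N j)) => s t /col[_ _ e].
  by rewrite form3B e subrr.
exists (fun j => (c 1%N j)%:MP), (fun i =>
  (nth 0 [:: c 0%N 1%N; 0; c 2%N 1%N - c 1%N 1%N; c 3%N 1%N] i)%:MP).
split=> [j|i|]; try exact: mpolyC_F2.
rewrite {1}(bicubic_expand hF).
exact: (form3_rat_cubic (@mpolyC (2 + 2) 'F_2) _ _ _ _ row0 row3 row21).
Qed.

(** * Factors of the bicubics *)

Section Factors.
Variables (R k : comNzRingType) (ev : {rmorphism R -> k}).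
Hypothesis char2 : 2%:R = 0 :> R.
Implicit Types (u v : R).

Definition irr_cubic u v : R := u ^+ 3 + u ^+ 2 * v + v ^+ 3.

(** The cases are governed by the zeros in P^1(F_2): a missing u^3 or v^3 gives
    the factor v or u, and a zero at (1,1) the factor u + v; only two cubics
    have no rational zero.  The morphism [ev]
    stands for evaluation at the origin, where factors of positive degree
    vanish. *)
Lemma cubic_cases (c : nat -> R) u v :
  (forall i, c i = 0 \/ c i = 1) -> ev u = 0 -> ev v = 0 ->
  (exists l A f, [/\ rat_cubic u v = l * A, form3 c u v = l * f,
                     ev l = 0 & ev A = 0])
  \/ form3 c u v = irr_cubic u v \/ form3 c u v = irr_cubic v u.
Proof.
move=> c01 u0 v0; rewrite /form3; case: (c01 3%N) => ->.
  left; exists v, (u * (u + v)), (c 2%N * u ^+ 2 + c 1%N * u * v + c 0%N * v ^+ 2).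
  by rewrite /rat_cubic rmorphM u0 mul0r; split=> //; ring.
case: (c01 0%N) => ->.
  left; exists u, (v * (u + v)), (u ^+ 2 + c 2%N * u * v + c 1%N * v ^+ 2).
  by rewrite /rat_cubic rmorphM v0 mul0r; split=> //; ring.
case: (c01 1%N) (c01 2%N) => -> [] ->; rewrite /irr_cubic.
- left; exists (u + v), (u * v), (u ^+ 2 - u * v + v ^+ 2).
  by rewrite /rat_cubic rmorphM rmorphD u0 v0 mul0r addr0; split=> //; ring.
- by right; left; ring.
- by right; right; ring.
- left; exists (u + v), (u * v), (u ^+ 2 + v ^+ 2).
  by rewrite /rat_cubic rmorphM rmorphD u0 v0 mul0r addr0; split=> //; ring.
Qed.

(** The quotient of A(x) phi(y) - A(y) phi(x), where A = [rat_cubic] and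
    phi = [irr_cubic], by x0 y1 - x1 y0. *)
Definition graph_cofactor (x0 x1 y0 y1 : R) : R :=
  x1 * y1 * (x0 * y1 + x1 * y0) + x1 ^+ 2 * y1 ^+ 2
  - x0 * x1 * y0 * y1 - x0 * y0 * (x0 * y1 + x1 * y0) - x0 ^+ 2 * y0 ^+ 2.

(** The left-hand side vanishes on the diagonal of P^1 x P^1. *)
Lemma graph_factor (x0 x1 y0 y1 : R) :
  rat_cubic x0 x1 * irr_cubic y0 y1 + rat_cubic y0 y1 * irr_cubic x0 x1
  = (x0 * y1 - x1 * y0) * graph_cofactor x0 x1 y0 y1.
Proof.
rewrite [LHS](_ : _ = (x0 * y1 - x1 * y0) * graph_cofactor x0 x1 y0 y1
    + 2%:R * (rat_cubic y0 y1 * irr_cubic x0 x1)).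
  by rewrite char2 mul0r addr0.
by rewrite /irr_cubic /graph_cofactor /rat_cubic; ring.
Qed.

(** Vanishing of both factors under [ev] is what makes them nonunits once [ev]
    is evaluation at the origin. *)
Lemma bicubic_factors (g f : nat -> R) (x0 x1 y0 y1 : R) :
  (forall i, g i = 0 \/ g i = 1) -> (forall i, f i = 0 \/ f i = 1) ->
  ev x0 = 0 -> ev x1 = 0 -> ev y0 = 0 -> ev y1 = 0 ->
  exists G H, [/\ ev G = 0, ev H = 0 &
    rat_cubic x0 x1 * form3 g y0 y1
    + rat_cubic y0 y1 * form3 f x0 x1 = G * H].
Proof.
move=> g01 f01 zx0 zx1 zy0 zy1.
have [[l [A [f' [eA ef zl zA]]]]|ef] := cubic_cases f01 zx0 zx1.
  exists l, (A * form3 g y0 y1 + rat_cubic y0 y1 * f'); split=> //.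
    by rewrite /rat_cubic rmorphD !rmorphM zA zy0 !mul0r addr0.
  by rewrite eA ef; ring.
have [[l [A [g' [eA eg zl zA]]]]|eg] := cubic_cases g01 zy0 zy1.
  exists l, (rat_cubic x0 x1 * g' + A * form3 f x0 x1); split=> //.
    by rewrite /rat_cubic rmorphD !rmorphM zA zx0 !mul0r addr0.
  by rewrite eA eg; ring.
(* Swapping u0, u1 or w0, w1 below reduces the four pairs of rootless cubics to
   the diagonal case. *)
have graph u0 u1 w0 w1 : ev u0 = 0 -> ev u1 = 0 -> ev w0 = 0 -> ev w1 = 0 ->
  exists G H, [/\ ev G = 0, ev H = 0 &
    rat_cubic u0 u1 * irr_cubic w0 w1 + rat_cubic w0 w1 * irr_cubic u0 u1 = G * H].
  move=> zu0 zu1 zw0 zw1.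
  exists (u0 * w1 - u1 * w0), (graph_cofactor u0 u1 w0 w1).
  split; [| | exact: graph_factor].
    by rewrite rmorphB !rmorphM /= zu0 zu1 !mul0r subr0.
  rewrite !(rmorphB, rmorphD, rmorphM, rmorphXn) /= zu0 zu1 ?expr0n.
  by rewrite !(mul0r, addr0, subr0).
case: ef => ->; case: eg => ->.
- exact: graph.
- by rewrite [rat_cubic y0 y1]rat_cubicC; apply: graph.
- by rewrite [rat_cubic x0 x1]rat_cubicC; apply: graph.
- by rewrite [rat_cubic x0 x1]rat_cubicC [rat_cubic y0 y1]rat_cubicC; apply: graph.
Qed.
End Factors.

Lemma filling_bicubic_reducible (F : {mpoly 'F_2[2 + 2]}) :
  bihomogeneous 3 3 F -> filling F -> ~ irreducible_mpoly F.
Proof.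
move=> hF fF; have [g [f [g01 f01 ->]]] := filling_bicubic hF fF.
pose ev : {rmorphism {mpoly 'F_2[2 + 2]} -> 'F_2} := meval (fun=> 0).
have evX i : ev 'X_i = 0 by rewrite /ev /= mevalXU.
have two0 : 2%:R = 0 :> {mpoly 'F_2[2 + 2]} :=
  rmorph_two_eq0 (@mpolyC (2 + 2) 'F_2) two_eq0_F2.
have [G [H [zG zH ->]]] :=
  bicubic_factors two0 g01 f01 (evX (coordX ord0)) (evX (coordX ord_max))
    (evX (coordY ord0)) (evX (coordY ord_max)).
case=> _ _ /(_ G H erefl).
by case=> /(rmorph_unit ev); rewrite ?zG ?zH unitr0.
Qed.

(** * Polynomials as univariate polynomials in one of their variables *)

Definition in_var (n : nat) (R : nzRingType) (i k : 'I_n) : {poly {mpoly R[n]}} :=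
  if k == i then 'X else ('X_k)%:P.

(** The other variables stay in the coefficients, which keep the type of the
    polynomial, so that evaluating at ['X_i] gives back the polynomial. *)
HB.lock Definition uni_in (n : nat) (R : comNzRingType) (i : 'I_n)
    (G : {mpoly R[n]}) : {poly {mpoly R[n]}} :=
  mmap (polyC \o @mpolyC n R) (in_var R i) G.

Section InVariable.
Variables (n : nat) (R : comNzRingType) (i : 'I_n).

Lemma uni_inE : uni_in i = mmap (polyC \o @mpolyC n R) (in_var R i).
Proof. by rewrite uni_in.unlock. Qed.

Fact uni_in_zmod_morphism : zmod_morphism (@uni_in n R i).
Proof. by rewrite uni_inE; apply: rmorphB. Qed.

Fact uni_in_monoid_morphism : monoid_morphism (@uni_in n R i).
Proof. by rewrite uni_inE; split; [apply: rmorph1 | apply: rmorphM]. Qed.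

HB.instance Definition _ :=
  GRing.isZmodMorphism.Build _ _ (@uni_in n R i) uni_in_zmod_morphism.
HB.instance Definition _ :=
  GRing.isMonoidMorphism.Build _ _ (@uni_in n R i) uni_in_monoid_morphism.

Lemma uni_inX k : uni_in i 'X_k = in_var R i k.
Proof. by rewrite uni_inE mmapX mmap1U. Qed.

Lemma uni_inC (c : R) : uni_in i c%:MP = c%:MP%:P.
Proof. by rewrite uni_inE; exact: (mmapC _ (polyC \o @mpolyC n R)). Qed.

End InVariable.

Section OneVariable.
Variables (n : nat) (R : idomainType) (i : 'I_n).
Implicit Types (G H : {mpoly R[n]}).

Lemma uni_inK G : (uni_in i G).['X_i] = G.
Proof.
elim/mpolyind: G => [|c m p _ _ IH]; first by rewrite rmorph0 horner0.
rewrite rmorphD hornerD /= IH; congr (_ + _).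
rewrite -mul_mpolyC rmorphM hornerM /= uni_inC hornerC; congr (_ * _).
rewrite uni_inE mmapX /mmap1 horner_prod [RHS]mpolyXE_id; apply: eq_bigr => k _.
by rewrite horner_exp /in_var; case: eqP => [->|_]; rewrite ?hornerX ?hornerC.
Qed.

(** A factor of degree 0 in a variable divides every coefficient of the product
    with respect to that variable. *)
Lemma uni_in_size1 G H : uni_in i (G * H) != 0 -> size (uni_in i G) = 1%N ->
  exists H', lead_coef (uni_in i (G * H)) = G * H'.
Proof.
move=> nz sG; exists (lead_coef (uni_in i H)).
rewrite rmorphM lead_coefM /=; congr (_ * _).
rewrite -{2}[G]uni_inK.
by have /eqP/size_poly1P[c _ ->] := sG; rewrite lead_coefC hornerC.
Qed.

Lemma dvd_of_root G c : (uni_in i G).[c] = 0 -> exists Q, G = Q * ('X_i - c).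
Proof.
move=> /eqP/factor_theorem[q eq_q]; exists q.['X_i].
by rewrite -{1}[G]uni_inK eq_q hornerM !hornerE.
Qed.

(** The linear polynomial X_i - c, with c free of X_i, is prime by the factor
    theorem; when it does not divide F it divides no factor G of F, so it can be
    cancelled from a multiple of G. *)
Lemma cancel_linear_factor F G H M c :
  (exists Q, F = G * Q) -> (uni_in i F).[c] != 0 ->
  G * H = ('X_i - c) * M -> 'X_i - c != 0 ->
  (uni_in i c).[c] = c -> exists H', G * H' = M.
Proof.
move=> [Q ->] nzF eGH nz cc.
have : (uni_in i (G * H)).[c] = 0.
  rewrite eGH rmorphM hornerM rmorphB hornerD hornerN /= cc.
  by rewrite uni_inX /in_var eqxx hornerX subrr mul0r.
rewrite rmorphM hornerM /= => /eqP; rewrite mulf_eq0 => /orP[] /eqP z.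
  by move: nzF; rewrite rmorphM hornerM /= z mul0r eqxx.
have [H' eH] := dvd_of_root z.
by exists H'; apply: (mulfI nz); rewrite -eGH eH; ring.
Qed.

End OneVariable.

(** * The (4,3) form *)

Definition fill_form (R : comNzRingType) (x0 x1 y0 y1 : R) : R :=
  rat_cubic x0 x1 * (x1 * y0 ^+ 3 + x0 * y1 ^+ 3)
  + (x0 ^+ 2 + x0 * x1 + x1 ^+ 2) ^+ 2 * rat_cubic y0 y1.

Lemma rmorph_fill_form (R S : comNzRingType) (f : {rmorphism R -> S}) x0 x1 y0 y1 :
  f (fill_form x0 x1 y0 y1) = fill_form (f x0) (f x1) (f y0) (f y1).
Proof. by rewrite /fill_form !(rmorphXn, rmorphM, rmorphD, rmorph_rat_cubic). Qed.

Lemma horner_fill_form (R : comNzRingType) (c : R) (x0 x1 y0 y1 : {poly R}) :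
  (fill_form x0 x1 y0 y1).[c] = fill_form x0.[c] x1.[c] y0.[c] y1.[c].
Proof. exact: (rmorph_fill_form (horner_eval c)). Qed.

Lemma uni_in_fill_form (n : nat) (R : comNzRingType) (i : 'I_n)
    (x0 x1 y0 y1 : {mpoly R[n]}) :
  uni_in i (fill_form x0 x1 y0 y1) =
    fill_form (uni_in i x0) (uni_in i x1) (uni_in i y0) (uni_in i y1).
Proof. exact: rmorph_fill_form. Qed.

Lemma fill_form_swap (R : comNzRingType) (x0 x1 y0 y1 : R) :
  fill_form x0 x1 y0 y1 = fill_form x1 x0 y1 y0.
Proof. by rewrite /fill_form /rat_cubic; ring. Qed.

Lemma bihomogeneous_fill_form (R : comNzRingType) a b c d
    (x0 x1 y0 y1 : {mpoly R[2 + 2]}) :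
  bihomogeneous a b x0 -> bihomogeneous a b x1 ->
  bihomogeneous c d y0 -> bihomogeneous c d y1 ->
  bihomogeneous (a * 4 + c * 3) (b * 4 + d * 3) (fill_form x0 x1 y0 y1).
Proof.
move=> hx0 hx1 hy0 hy1; apply: bihomogeneousD.
  rewrite ![(_ * 4)%N]mulnSr -!addnA; apply: bihomogeneousM.
    exact: bihomogeneous_rat_cubic.
  by apply: bihomogeneousD; apply: bihomogeneousM => //; apply: bihomogeneousX.
apply: bihomogeneousM; last exact: bihomogeneous_rat_cubic.
rewrite -[(a * 4)%N]/(a * (2 * 2))%N -[(b * 4)%N]/(b * (2 * 2))%N !mulnA.
apply: bihomogeneousX.
apply: bihomogeneousD; last exact: bihomogeneousX.
apply: bihomogeneousD; first exact: bihomogeneousX.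
by rewrite !mulnSr !muln0 !add0n; apply: bihomogeneousM.
Qed.

Lemma filling_fill_form (x0 x1 y0 y1 : 'I_(2 + 2)) :
  filling (fill_form 'X_x0 'X_x1 'X_y0 'X_y1 : {mpoly 'F_2[2 + 2]}).
Proof.
apply/setP => p; rewrite inE andb_idr // => _.
rewrite /eval_at (rmorph_fill_form (meval _)) /= !mevalXU /fill_form.
by rewrite !rat_cubic_F2 mul0r mulr0 addr0.
Qed.

(** * Irreducibility *)

(** Cubes in F_4 are 0 or 1, since its unit group has order 3; a root of
    t^2 + t + 1 is neither. *)
Lemma exists_F4 : exists (L : finFieldType) (e : {rmorphism 'F_2 -> L}) (w : L),
  w ^+ 2 + w + 1 = 0 /\ forall x : L, x ^+ 3 != w.
Proof.
have [L charL cardL] := @pPrimePowerField 2 2 isT isT.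
pose e : {rmorphism 'F_2 -> pPrimeCharType charL} :=
  GRing.in_alg (pPrimeCharType charL).
have [w /andP[w0 w1]] : exists w : L, (w != 0) && (w != 1).
  apply/existsP; apply: contraT => /existsPn h.
  have : (#|L| <= #|pred2 (0 : L)%R 1%R|)%N.
    apply/subset_leq_card/subsetP => x _; rewrite !inE.
    by move: (h x); rewrite negb_and !negbK.
  by rewrite card2 cardL; case: (_ != _).
have cube1 (x : L) : x != 0 -> x ^+ 3 = 1.
  move=> nz; apply: (mulfI nz); rewrite -exprS mulr1.
  by rewrite -{2}[x]expf_card cardL.
have root_w : w ^+ 2 + w + 1 = 0.
  have w1' : w - 1 != 0 by rewrite subr_eq0.
  apply: (mulfI w1'); rewrite mulr0.
  by apply: etrans (_ : w ^+ 3 - 1 = 0); [ring | rewrite cube1 // subrr].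
exists L, (e : {rmorphism 'F_2 -> L}), w; split=> // x; have [->|/cube1->] := eqVneq x 0.
  by rewrite expr0n /= eq_sym.
by rewrite eq_sym.
Qed.

Section Irreducible.
Variables (k L : fieldType) (e : {rmorphism k -> L}) (w : L).
Hypothesis char2 : 2%:R = 0 :> k.
Hypothesis root_w : w ^+ 2 + w + 1 = 0.
Hypothesis not_cube : forall x : L, x ^+ 3 != w.
Variables (n : nat) (i0 i1 j0 j1 : 'I_n).
Hypothesis distinct : uniq [:: i0; i1; j0; j1].
Let F : {mpoly k[n]} := fill_form 'X_i0 'X_i1 'X_j0 'X_j1.

Let two_eq0 : 2%:R = 0 :> {mpoly k[n]}.
Proof. exact: (rmorph_two_eq0 (@mpolyC n k)). Qed.

Let oppr_char2 (x : {mpoly k[n]}) : - x = x.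
Proof. exact: oppr_two_eq0. Qed.

Let neqs : ((i0 == i1 = false) * (i0 == j0 = false) * (i0 == j1 = false)
  * (i1 == j0 = false) * (i1 == j1 = false) * (j0 == j1 = false)
  * (i1 == i0 = false) * (j0 == i0 = false) * (j1 == i0 = false)
  * (j0 == i1 = false) * (j1 == i1 = false) * (j1 == j0 = false))%type.
Proof.
move: distinct; rewrite /= !inE !negb_or => /and4P[/and3P[? ? ?] /andP[? ?] ? _].
by do !split; apply/negbTE => //; rewrite eq_sym.
Qed.

Let uniF : uni_in j0 F = fill_form ('X_i0)%:P ('X_i1)%:P 'X ('X_j1)%:P.
Proof. by rewrite uni_in_fill_form 4!uni_inX /in_var eqxx !neqs. Qed.

Let uniF_coef : uni_in j0 F = Poly
  [:: rat_cubic 'X_i0 'X_i1 * 'X_i0 * 'X_j1 ^+ 3;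
      ('X_i0 ^+ 2 + 'X_i0 * 'X_i1 + 'X_i1 ^+ 2) ^+ 2 * 'X_j1 ^+ 2;
      ('X_i0 ^+ 2 + 'X_i0 * 'X_i1 + 'X_i1 ^+ 2) ^+ 2 * 'X_j1;
      rat_cubic 'X_i0 'X_i1 * 'X_i1].
Proof.
rewrite uniF /fill_form /rat_cubic /= !cons_poly_def !(rmorphXn, rmorphM, rmorphD) /=.
by move: (('X_i0)%:P) (('X_i1)%:P) (('X_j1)%:P) => a b c; ring.
Qed.

Let X_nz i : 'X_i != 0 :> {mpoly k[n]}.
Proof.
by apply/eqP => /(congr1 (meval (fun=> 1))) /eqP; rewrite mevalXU meval0 oner_eq0.
Qed.

Let XD_nz i j : i != j -> 'X_i + 'X_j != 0 :> {mpoly k[n]}.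
Proof.
move=> /negbTE ij; apply/eqP => /(congr1 (meval (fun l => (l == j)%:R))) /eqP.
by rewrite mevalD !mevalXU meval0 eqxx ij add0r oner_eq0.
Qed.

Let rat_cubic_nz i j : i != j -> rat_cubic 'X_i 'X_j != 0 :> {mpoly k[n]}.
Proof. by move=> ij; rewrite !mulf_neq0 ?X_nz ?XD_nz. Qed.

Let lead_nz : rat_cubic 'X_i0 'X_i1 * 'X_i1 != 0 :> {mpoly k[n]}.
Proof. by rewrite mulf_neq0 ?X_nz ?rat_cubic_nz ?neqs. Qed.

Let uniF_seq : uni_in j0 F =
  [:: rat_cubic 'X_i0 'X_i1 * 'X_i0 * 'X_j1 ^+ 3;
      ('X_i0 ^+ 2 + 'X_i0 * 'X_i1 + 'X_i1 ^+ 2) ^+ 2 * 'X_j1 ^+ 2;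
      ('X_i0 ^+ 2 + 'X_i0 * 'X_i1 + 'X_i1 ^+ 2) ^+ 2 * 'X_j1;
      rat_cubic 'X_i0 'X_i1 * 'X_i1] :> seq _.
Proof. by rewrite uniF_coef (@PolyK _ 0). Qed.

Let size_uniF : size (uni_in j0 F) = 4%N.
Proof. by rewrite uniF_seq. Qed.

Let lead_uniF : lead_coef (uni_in j0 F) = rat_cubic 'X_i0 'X_i1 * 'X_i1.
Proof. by rewrite lead_coefE uniF_seq. Qed.

Let uniF_nz : uni_in j0 F != 0.
Proof. by rewrite -size_poly_eq0 size_uniF. Qed.

Let fixed_var i j : i != j -> (uni_in i 'X_j).['X_j] = 'X_j :> {mpoly k[n]}.
Proof. by move=> ij; rewrite uni_inX /in_var eq_sym (negbTE ij) hornerC. Qed.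

(** Such a factor divides the leading coefficient X_0 X_1^2 (X_0 + X_1), whose
    linear factors are cancelled one at a time because none divides F: modulo
    X_0, X_1 or X_0 + X_1 the form F is a fourth power times [rat_cubic] of Y. *)
Let unit_of_size1 (G H : {mpoly k[n]}) : F = G * H -> size (uni_in j0 G) = 1%N ->
  G \is a GRing.unit.
Proof.
move=> eF sG; have dvdF : exists Q, F = G * Q by exists H.
have [|H'] := uni_in_size1 (H := H) _ sG; first by rewrite -eF.
rewrite -eF lead_uniF => e0.
have hornerF i (c : {mpoly k[n]}) : (uni_in i F).[c] = fill_form
    (in_var k i i0).[c] (in_var k i i1).[c] (in_var k i j0).[c] (in_var k i j1).[c].
  by rewrite uni_in_fill_form horner_fill_form 4!uni_inX.
have root0 : (uni_in i0 F).[0] != 0.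
  rewrite hornerF /in_var eqxx !neqs hornerX !hornerC.
  rewrite (_ : fill_form _ _ _ _ = 'X_i1 ^+ 4 * rat_cubic 'X_j0 'X_j1).
    by rewrite mulf_neq0 ?expf_neq0 ?X_nz ?rat_cubic_nz ?neqs.
  by rewrite /fill_form /rat_cubic; ring.
have root1 : (uni_in i1 F).[0] != 0.
  rewrite hornerF /in_var eqxx !neqs hornerX !hornerC.
  rewrite (_ : fill_form _ _ _ _ = 'X_i0 ^+ 4 * rat_cubic 'X_j0 'X_j1).
    by rewrite mulf_neq0 ?expf_neq0 ?X_nz ?rat_cubic_nz ?neqs.
  by rewrite /fill_form /rat_cubic; ring.
have root01 : (uni_in i0 F).['X_i1] != 0.
  rewrite hornerF /in_var eqxx !neqs hornerX !hornerC.
  (* Over the integers the last term of F becomes 9 X_1^4 A(Y), and 9 = 1 + 2 * 4. *)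
  rewrite (_ : fill_form _ _ _ _ = 'X_i1 ^+ 4 * rat_cubic 'X_j0 'X_j1 + 2%:R *
      ('X_i1 ^+ 4 * ('X_j0 ^+ 3 + 'X_j1 ^+ 3 + 4%:R * rat_cubic 'X_j0 'X_j1))).
    rewrite two_eq0 mul0r addr0.
    by rewrite mulf_neq0 ?expf_neq0 ?X_nz ?rat_cubic_nz ?neqs.
  by rewrite /fill_form /rat_cubic; ring.
have [H1 e1] : exists H1, G * H1 = 'X_i1 * (('X_i0 + 'X_i1) * 'X_i1).
  apply: (cancel_linear_factor (i := i0) (c := 0) (H := H') dvdF); rewrite ?subr0 ?X_nz //.
    by rewrite -e0 /rat_cubic; ring.
  by rewrite rmorph0 horner0.
have [H2 e2] : exists H2, G * H2 = ('X_i0 + 'X_i1) * 'X_i1.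
  apply: (cancel_linear_factor (i := i1) (c := 0) (H := H1) dvdF); rewrite ?subr0 ?X_nz //.
  by rewrite rmorph0 horner0.
have [H3 e3] : exists H3, G * H3 = ('X_i0 + 'X_i1).
  apply: (cancel_linear_factor (i := i1) (c := 0) (H := H2) dvdF); rewrite ?subr0 ?X_nz //.
    by rewrite e2; ring.
  by rewrite rmorph0 horner0.
have [H4 e4] : exists H4, G * H4 = 1.
  apply: (cancel_linear_factor (i := i0) (c := 'X_i1) (H := H3) dvdF) => //.
  - by rewrite e3 mulr1 oppr_char2.
  - by rewrite oppr_char2 XD_nz ?neqs.
  - by rewrite fixed_var // neqs.
by apply/unitrPr; exists H4.
Qed.

(** At X = (w,1), Y_1 = 1 the leading coefficient of F is w^2 + w = 1, so the
    factor stays linear and has a root r, and F becomes r^3 + w. *)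
Let no_linear_factor (G H : {mpoly k[n]}) : F = G * H -> size (uni_in j0 G) <> 2%N.
Proof.
move=> eF sG.
pose v i := if i == i0 then w else 1.
pose ev : {rmorphism {mpoly k[n]} -> L} := mmap e v.
have evX i : ev 'X_i = v i by rewrite /ev /= mmapX mmap1U.
have lead_ev : ev (lead_coef (uni_in j0 F)) != 0.
  rewrite lead_uniF rmorphM rmorph_rat_cubic !evX /v eqxx !neqs /rat_cubic !mulr1.
  apply/eqP => z; have := root_w; rewrite (_ : _ + 1 = w * (w + 1) + 1); last by ring.
  by rewrite z add0r => /eqP; rewrite oner_eq0.
have [r /rootP root_r] : exists r, root (map_poly ev (uni_in j0 G)) r.
  have : size (map_poly ev (uni_in j0 G)) = 2%N.
    rewrite size_map_poly_id0 //.
    by apply: contraNneq lead_ev; rewrite eF rmorphM lead_coefM rmorphM => ->; rewrite mul0r.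
  move: (map_poly _ _) => p sp; exists (- p`_0 / p`_1).
  have p1 : p`_1 != 0 by rewrite -[1%N]/(2.-1) -sp -lead_coefE lead_coef_eq0 -size_poly_gt0 sp.
  rewrite /root (@horner_coef_wide _ 2) ?sp // big_ord_recl big_ord1 /= expr0 mulr1.
  by rewrite expr1 mulrCA divff // mulr1 subrr.
have : (map_poly ev (uni_in j0 F)).[r] = 0.
  by rewrite eF !rmorphM hornerM root_r mul0r.
rewrite uniF (rmorph_fill_form (map_poly ev)) /= !map_polyC map_polyX /= !evX.
rewrite /v eqxx !neqs horner_fill_form !hornerC hornerX.
have two_L : 2%:R = 0 :> L := rmorph_two_eq0 e char2.
(* The value is r^3 + w up to multiples of w^2 + w + 1 and of 2. *)
rewrite (_ : fill_form _ _ _ _ =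
  (w ^+ 2 + w + 1) * (r ^+ 3 + w + (w ^+ 2 + w + 1) * (r ^+ 2 + r))
  + (r ^+ 3 + w) - 2%:R * (r ^+ 3 + w)); last by rewrite /fill_form /rat_cubic; ring.
rewrite root_w two_L !mul0r add0r subr0 => /eqP.
rewrite addr_eq0 => /eqP r3; case/negP: (not_cube r); rewrite r3.
by rewrite oppr_two_eq0.
Qed.

Lemma fill_form_irreducible : irreducible_mpoly F.
Proof.
split.
- by apply: contraNneq uniF_nz => ->; rewrite rmorph0.
- apply/negP => /(rmorph_unit (meval (fun=> 0))).
  rewrite rmorph_fill_form /= !mevalXU /fill_form /rat_cubic.
  by rewrite !(mul0r, mulr0, addr0) unitr0.
move=> G H eF; have [sG|sG] := eqVneq (size (uni_in j0 G)) 1%N.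
  by left; apply: unit_of_size1 eF sG.
have [sH|sH] := eqVneq (size (uni_in j0 H)) 1%N.
  by right; apply: unit_of_size1 sH; rewrite mulrC; exact: eF.
have nG := no_linear_factor eF.
have nH : size (uni_in j0 H) <> 2%N.
  by apply: (no_linear_factor (H := G)); rewrite mulrC.
have := uniF_nz; have := size_uniF.
rewrite eF rmorphM mulf_eq0 negb_or => sGH /andP[zG zH].
(* The degrees in Y_0 are at least 2 each but add up to 3. *)
have big m : (0 < m)%N -> m != 1%N -> m <> 2%N -> (2 < m)%N.
  by case: m => [|[|[|m]]].
move: (size_mul zG zH); rewrite sGH.
rewrite -size_poly_gt0 in zG; rewrite -size_poly_gt0 in zH.
have := leq_add (big _ zG sG nG) (big _ zH sH nH).
by case: (size _ + size _)%N => [|[|[|[|[|[|m]]]]]].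
Qed.
End Irreducible.

(** * Smoothness *)

Section Charts.
Variable K : fieldType.
Hypothesis char2 : 2%:R = 0 :> K.
Implicit Types x y : K.

Let oppff x : - x = x.
Proof. exact: oppr_two_eq0. Qed.

Let eq_of_add x y : x + y = 0 -> x = y.
Proof. by move/eqP; rewrite addr_eq0 oppff => /eqP. Qed.

Let form_nz x (c : K) : (x ^+ 2 + x + 1) ^+ 2 = (x ^+ 2 + x) * c -> x ^+ 2 + x != 0.
Proof.
move=> e; apply/eqP => z; move: e; rewrite z mul0r add0r expr1n.
by move/eqP; rewrite oner_eq0.
Qed.

Let form_sqr x : (x ^+ 2 + x + 1) ^+ 2 = x ^+ 4 + x ^+ 2 + 1.
Proof.
rewrite (_ : _ ^+ 2 = x ^+ 4 + x ^+ 2 + 1 + 2%:R * (x ^+ 3 + x ^+ 2 + x)).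
  by rewrite char2 mul0r addr0.
by ring.
Qed.

(** This is the chart X_1 = Y_1 = 1, with the two partial derivatives reduced
    modulo 2.  With u = x^2 + x the relations read y^3 = x^2 and (u + 1)^2 = u y^2, so u is
    nonzero; the equation then gives u = y^4 + y^3, whence x = y^4, y^8 = y^3 and
    y^5 = 1, and the second relation leaves y^3 = 0. *)
Lemma smooth_chart_same x y :
  (x ^+ 2 + x) * (y ^+ 3 + x) + (x ^+ 2 + x + 1) ^+ 2 * (y ^+ 2 + y) = 0 ->
  y ^+ 3 + x ^+ 2 = 0 ->
  (x ^+ 2 + x + 1) ^+ 2 + (x ^+ 2 + x) * y ^+ 2 = 0 -> False.
Proof.
move=> f0 /eq_of_add fx /eq_of_add fy; have u_nz := form_nz fy.
have eu : x ^+ 2 + x = y ^+ 4 + y ^+ 3.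
  apply: eq_of_add; apply: (mulfI u_nz); rewrite mulr0 -{}f0 fy.
  have -> : y ^+ 3 + x = x ^+ 2 + x by rewrite fx.
  ring.
have ex : x = y ^+ 4 by move: eu; rewrite fx addrC => /addIr.
have y_nz : y != 0.
  by apply: contraNneq u_nz => y0; rewrite ex y0 !expr0n addr0.
have y8 : y ^+ 8 = y ^+ 3 by rewrite fx ex -exprM.
have y5 : y ^+ 5 = 1.
  by apply: (mulfI (expf_neq0 3 y_nz)); rewrite -exprD y8 mulr1.
suff : y ^+ 3 = 0 by move/eqP; rewrite expf_eq0 (negbTE y_nz).
move: fy; rewrite form_sqr eu.
have -> : x ^+ 4 = y.
  have y16 : (y ^+ 4) ^+ 4 = (y ^+ 5) ^+ 3 * y by ring.
  by rewrite ex y16 y5 expr1n mul1r.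
have -> : (y ^+ 4 + y ^+ 3) * y ^+ 2 = y ^+ 5 * y + y ^+ 5 by ring.
rewrite -fx y5 mul1r => e; apply: (addrI (y + 1)); rewrite addr0 -[RHS]e; ring.
Qed.

(** This is the chart X_0 = Y_1 = 1, with the two partial derivatives reduced
    modulo 2.  With u = x^2 + x the relations read x^2 y^3 = 1 and (u + 1)^2 = u x y^2, so u
    is nonzero; the equation then gives x y^4 = 1, whence y = x and x^5 = 1, and
    the second relation leaves x^2 = 0. *)
Lemma smooth_chart_mixed x y :
  (x ^+ 2 + x) * (x * y ^+ 3 + 1) + (x ^+ 2 + x + 1) ^+ 2 * (y ^+ 2 + y) = 0 ->
  x ^+ 2 * y ^+ 3 + 1 = 0 ->
  (x ^+ 2 + x + 1) ^+ 2 + (x ^+ 2 + x) * (x * y ^+ 2) = 0 -> False.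
Proof.
move=> f0 /eq_of_add fx /eq_of_add fy; have u_nz := form_nz fy.
have xy4 : x * y ^+ 4 = 1.
  apply: eq_of_add; apply: (mulfI u_nz); rewrite mulr0 -[RHS]f0 fy.
  rewrite [RHS](_ : _ = (x ^+ 2 + x) * (x * y ^+ 4 + 1)
    + 2%:R * ((x ^+ 2 + x) * x * y ^+ 3)); last by ring.
  by rewrite char2 mul0r addr0.
have x_nz : x != 0.
  by apply: contra_eq_neq xy4 => ->; rewrite mul0r eq_sym oner_eq0.
have y_nz : y != 0.
  by apply: contra_eq_neq xy4 => ->; rewrite expr0n mulr0 eq_sym oner_eq0.
have exy : y = x.
  apply: (mulfI (mulf_neq0 x_nz (expf_neq0 3 y_nz))).
  by rewrite -mulrA -exprSr xy4 -fx; ring.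
have x5 : x ^+ 5 = 1 by rewrite -xy4 exy -exprS.
move: fy; rewrite form_sqr exy [RHS](_ : _ = x ^+ 5 + x ^+ 4); last by ring.
rewrite x5 => e; suff : x ^+ 2 = 0 by move/eqP; rewrite expf_eq0 (negbTE x_nz).
apply: (addrI (x ^+ 4 + 1)); rewrite addr0 [RHS]addrC -e; ring.
Qed.
End Charts.

Lemma mderivU (n : nat) (R : nzRingType) (i j : 'I_n) :
  ('X_j)^`M(i) = (j == i)%:R :> {mpoly R[n]}.
Proof.
rewrite mderivX mnm1E; case: eqP => [->|_]; last by rewrite scale0r.
rewrite scale1r (_ : (_ - _)%MM = 0%MM) ?mpolyX0 //.
by apply/mnmP => k; rewrite mnmBE subnn mnm0E.
Qed.

Section Singular.
Variables (K : fieldType) (s t : 'I_2).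
Hypothesis char2 : 2%:R = 0 :> K.
Hypothesis st : s != t.

Let mderiv_simp := (mderivM, mderivD, mderivC, mderivU, eqxx, negbTE st,
  etrans (eq_sym _ _) (negbTE st), mulr1n, mulr0n).
Let meval_simp := (mevalM, mevalD, mevalXU, rmorphXn, meval1).

(* In the uses of this fact, [h] is half the difference between the derivative
   computed over the integers and its reduced form [g]. *)
Let eq_mod2 (f g h : {mpoly K[2]}) : f = g + 2%:R * h -> f = g.
Proof.
by move=> ->; rewrite (rmorph_two_eq0 (@mpolyC 2 K) char2) mul0r addr0.
Qed.

Lemma smooth_fill_form_same z : ~ affine_singular_point
  (fill_form 'X_s 1 'X_t 1 : {mpoly K[2]}) z.
Proof.
case=> f0 df; apply: (@smooth_chart_same K char2 (z s) (z t)).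
- by rewrite -[RHS]f0 /fill_form /rat_cubic !meval_simp /=; ring.
- rewrite -[RHS](df s) (_ : mderiv s _ = 'X_t ^+ 3 + 'X_s ^+ 2) ?meval_simp //=.
  rewrite /fill_form /rat_cubic !exprS !expr0 !mderiv_simp.
  move: 'X_s 'X_t => x y.
  apply: (eq_mod2 (h := x + x * y ^+ 3 + x ^+ 2
    + (x ^+ 2 + x + 1) * (2%:R * x + 1) * (y ^+ 2 + y))); ring.
- rewrite -[RHS](df t) (_ : mderiv t _ =
    ('X_s ^+ 2 + 'X_s + 1) ^+ 2 + ('X_s ^+ 2 + 'X_s) * 'X_t ^+ 2) ?meval_simp //=.
  rewrite /fill_form /rat_cubic !exprS !expr0 !mderiv_simp.
  move: 'X_s 'X_t => x y.
  apply: (eq_mod2 (h := (x ^+ 2 + x) * y ^+ 2 + (x ^+ 2 + x + 1) ^+ 2 * y)).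
  ring.
Qed.

Lemma smooth_fill_form_mixed z : ~ affine_singular_point
  (fill_form 1 'X_s 'X_t 1 : {mpoly K[2]}) z.
Proof.
case=> f0 df; apply: (@smooth_chart_mixed K char2 (z s) (z t)).
- by rewrite -[RHS]f0 /fill_form /rat_cubic !meval_simp /=; ring.
- rewrite -[RHS](df s) (_ : mderiv s _ = 'X_s ^+ 2 * 'X_t ^+ 3 + 1) ?meval_simp //=.
  rewrite /fill_form /rat_cubic !exprS !expr0 !mderiv_simp.
  move: 'X_s 'X_t => x y.
  apply: (eq_mod2 (h := x + x * y ^+ 3 + x ^+ 2 * y ^+ 3
    + (x ^+ 2 + x + 1) * (2%:R * x + 1) * (y ^+ 2 + y))); ring.
- rewrite -[RHS](df t) (_ : mderiv t _ =
    ('X_s ^+ 2 + 'X_s + 1) ^+ 2 + ('X_s ^+ 2 + 'X_s) * ('X_s * 'X_t ^+ 2))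
    ?meval_simp //=.
  rewrite /fill_form /rat_cubic !exprS !expr0 !mderiv_simp.
  move: 'X_s 'X_t => x y.
  apply: (eq_mod2 (h := (x ^+ 2 + x) * (x * y ^+ 2)
    + (x ^+ 2 + x + 1) ^+ 2 * y)).
  ring.
Qed.
End Singular.

Section Dehomogenize.
Variables (R : comNzRingType) (i j : 'I_2).

Lemma dehomogenizeX (l : 'I_2) :
  dehomogenize i j 'X_(coordX l) = (if l == i then 1 else 'X_ord0) :> {mpoly R[2]}.
Proof.
rewrite /dehomogenize comp_mpolyXU -tnth_nth tnth_mktuple.
by rewrite -[coordX l]/(unsplit (inl l)) unsplitK.
Qed.

Lemma dehomogenizeY (l : 'I_2) :
  dehomogenize i j 'X_(coordY l) = (if l == j then 1 else 'X_ord_max) :> {mpoly R[2]}.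
Proof.
rewrite /dehomogenize comp_mpolyXU -tnth_nth tnth_mktuple.
by rewrite -[coordY l]/(unsplit (inr l)) unsplitK.
Qed.

Lemma dehomogenize_fill_form x0 x1 y0 y1 :
  dehomogenize i j (fill_form x0 x1 y0 y1) =
  fill_form (dehomogenize i j x0) (dehomogenize i j x1)
    (dehomogenize i j y0) (dehomogenize i j y1) :> {mpoly R[2]}.
Proof. exact: (rmorph_fill_form (comp_mpoly _)). Qed.
End Dehomogenize.

Lemma map_fill_form (n : nat) (R S : comNzRingType) (e : {rmorphism R -> S})
    (x0 x1 y0 y1 : {mpoly R[n]}) :
  map_mpoly e (fill_form x0 x1 y0 y1) =
  fill_form (map_mpoly e x0) (map_mpoly e x1) (map_mpoly e y0) (map_mpoly e y1).
Proof. exact: (rmorph_fill_form (map_mpoly e)). Qed.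

Definition curve43 : {mpoly 'F_2[2 + 2]} :=
  fill_form 'X_(coordX ord0) 'X_(coordX ord_max) 'X_(coordY ord0) 'X_(coordY ord_max).

Definition curve34 : {mpoly 'F_2[2 + 2]} :=
  fill_form 'X_(coordY ord0) 'X_(coordY ord_max) 'X_(coordX ord0) 'X_(coordX ord_max).

Lemma nonsingular43 : nonsingular curve43.
Proof.
move=> K e _ i j z; have two0 := rmorph_two_eq0 e two_eq0_F2.
have neq : ord0 != ord_max :> 'I_2 by [].
rewrite /curve43 map_fill_form !map_mpolyX dehomogenize_fill_form.
rewrite !(dehomogenizeX, dehomogenizeY).
case: (ord2P i) (ord2P j) => -> [] ->; rewrite /=.
- rewrite fill_form_swap; exact: smooth_fill_form_same.
- rewrite fill_form_swap [fill_form _ _ _ _]fill_form_swap; exact: smooth_fill_form_mixed.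
- rewrite fill_form_swap; exact: smooth_fill_form_mixed.
- exact: smooth_fill_form_same.
Qed.

Lemma nonsingular34 : nonsingular curve34.
Proof.
move=> K e _ i j z; have two0 := rmorph_two_eq0 e two_eq0_F2.
have neq : ord_max != ord0 :> 'I_2 by [].
rewrite /curve34 map_fill_form !map_mpolyX dehomogenize_fill_form.
rewrite !(dehomogenizeX, dehomogenizeY).
case: (ord2P i) (ord2P j) => -> [] ->; rewrite /=.
- rewrite fill_form_swap; exact: smooth_fill_form_same.
- rewrite fill_form_swap; exact: smooth_fill_form_mixed.
- exact: smooth_fill_form_mixed.
- exact: smooth_fill_form_same.
Qed.

(** * The curves of bi-degrees (4,3) and (3,4) *)

Lemma curve_fill_form (i0 i1 j0 j1 : 'I_(2 + 2)) a b c d :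
  uniq [:: i0; i1; j0; j1] ->
  bihomogeneous a b ('X_i0 : {mpoly 'F_2[2 + 2]}) ->
  bihomogeneous a b ('X_i1 : {mpoly 'F_2[2 + 2]}) ->
  bihomogeneous c d ('X_j0 : {mpoly 'F_2[2 + 2]}) ->
  bihomogeneous c d ('X_j1 : {mpoly 'F_2[2 + 2]}) ->
  let F := fill_form 'X_i0 'X_i1 'X_j0 'X_j1 : {mpoly 'F_2[2 + 2]} in
  [/\ curve_equation (a * 4 + c * 3) (b * 4 + d * 3) F, irreducible_mpoly F & filling F].
Proof.
move=> distinct h0 h1 h2 h3 F.
have [L [e [w [root_w not_cube]]]] := exists_F4.
have irr : irreducible_mpoly F.
  by apply: (fill_form_irreducible e two_eq0_F2 root_w not_cube).
split=> //; last exact: filling_fill_form.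
by split; [case: irr | apply: bihomogeneous_fill_form].
Qed.

Theorem theorem4p1 :
  (~ exists F : {mpoly 'F_2[2 + 2]},
       [/\ curve_equation 3 3 F, irreducible_mpoly F & filling F])
  /\ (exists F : {mpoly 'F_2[2 + 2]},
       [/\ curve_equation 4 3 F, irreducible_mpoly F, nonsingular F & filling F])
  /\ (exists F : {mpoly 'F_2[2 + 2]},
       [/\ curve_equation 3 4 F, irreducible_mpoly F, nonsingular F & filling F]).
Proof.
split=> [[F [[_ hF] irrF fF]]|]; first exact: filling_bicubic_reducible hF fF irrF.
have bihX := @bihomogeneous_coordX 'F_2; have bihY := @bihomogeneous_coordY 'F_2.
split; [exists curve43 | exists curve34].
  have [//|//|//|//|//|eqn irr fill] := @curve_fill_form
    (coordX ord0) (coordX ord_max) (coordY ord0) (coordY ord_max) 1 0 0 1.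
  by split=> //; apply: nonsingular43.
have [//|//|//|//|//|eqn irr fill] := @curve_fill_form
  (coordY ord0) (coordY ord_max) (coordX ord0) (coordX ord_max) 0 1 1 0.
by split=> //; apply: nonsingular34.
Qed.
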